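(* If $G$ is a CI$\mathcal{O}$ graph, then every induced subgraph $H$ of $G$ is a CI$\mathcal{O}$ graph.
   Context: All graphs are finite and simple; $k$ is a field. Given a graph $G$ with vertices $x_1,\dots,x_n$, $q$ edges and $r$ connected components, and an orientation $\mathcal{O}$ of its edges, $D=G_{\mathcal{O}}$ is the resulting oriented graph, with edges $t_1,\dots,t_q$. The toric ideal $P_D$ is the kernel of the $k$-algebra map $\varphi:k[t_1,\dots,t_q]\to k[x_1^{\pm1},\dots,x_n^{\pm1}]$ sending an edge $t_\ell=(x_i,x_j)$ (from $x_i$ to $x_j$) to $x_jx_i^{-1}$. It has height $q-n+r$. $P_D$ is a binomial complete intersection if it can be generated by $q-n+r$ binomials (polynomials of the form $t^\alpha-t^\beta$). $G$ is a CI$\mathcal{O}$ graph if $P_{G_{\mathcal{O}}}$ is a binomial complete intersection for every orientation $\mathcal{O}$ of $G$. *)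

(* Defs.v *)
From HB Require Import structures.
From mathcomp Require Import all_boot all_order all_algebra.
From mathcomp Require Import fraction.
From mathcomp.multinomials Require Import mpoly.

Set Implicit Arguments.
Unset Strict Implicit.
Unset Printing Implicit Defensive.

Import GRing.Theory.
Local Open Scope ring_scope.

Record sgraph := SGraph {
  vertex :> finType;
  adj : rel vertex;
  adj_sym : ssrbool.symmetric adj;
  adj_irrefl : irreflexive adj
}.

Section Induced.
Variables (G : sgraph) (W : {set G}).

Definition induced_adj : rel {x : G | x \in W} := relpre val (@adj G).

Lemma induced_adj_sym : ssrbool.symmetric induced_adj.
Proof. by move=> x y; apply: adj_sym. Qed.

Lemma induced_adj_irrefl : irreflexive induced_adj.
Proof. by move=> x; apply: adj_irrefl. Qed.

Definition induced : sgraph := SGraph induced_adj_sym induced_adj_irrefl.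
End Induced.

(* arc x y : the edge {x, y} is directed from x to y. *)
Record orientation (G : sgraph) := Orientation {
  arc : rel G;
  arc_adj : forall x y, adj x y = arc x y || arc y x;
  arc_anti : forall x y, arc x y -> ~~ arc y x
}.

Section Ideals.
Variables (k : fieldType) (n : nat).

Definition is_binomial (p : {mpoly k[n]}) : Prop :=
  exists a b : 'X_{1..n}, p = 'X_[a] - 'X_[b].

Definition generates (h : nat) (g : 'I_h -> {mpoly k[n]})
    (I : {pred {mpoly k[n]}}) : Prop :=
  forall p, p \in I <->
    exists c : 'I_h -> {mpoly k[n]}, p = \sum_(i < h) c i * g i.

(* k[x_1^{+-1}, ..., x_n^{+-1}] as a subring of k(x_1, ..., x_n). *)
Definition is_laurent (f : {fraction {mpoly k[n]}}) : Prop :=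
  exists (p : {mpoly k[n]}) (m : 'X_{1..n}),
    f = FracField.tofrac p / FracField.tofrac 'X_[m].
End Ideals.

Section Toric.
Variables (k : fieldType) (G : sgraph) (D : orientation G).

Definition arcs : {set G * G} := [set a | arc D a.1 a.2].
Definition nb_vertices : nat := #|G|.
Definition nb_edges : nat := #|arcs|.
Definition nb_components : nat := n_comp (@adj G) G.

Definition arc_tail (l : 'I_nb_edges) : G := (enum_val l).1.
Definition arc_head (l : 'I_nb_edges) : G := (enum_val l).2.

Definition xvar (v : G) : {fraction {mpoly k[nb_vertices]}} :=
  FracField.tofrac 'X_(enum_rank v).

(* The codomain is the fraction field of k[x_1, ..., x_n]; the values lie in
   its subring of Laurent polynomials (toric_map_laurent), so the kernel is the
   same as for the map to the Laurent polynomial ring. *)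
Definition toric_map (p : {mpoly k[nb_edges]}) :
    {fraction {mpoly k[nb_vertices]}} :=
  mmap (fun c : k => FracField.tofrac c%:MP)
       (fun l => xvar (arc_head l) * (xvar (arc_tail l))^-1) p.

Definition toric_ideal : {pred {mpoly k[nb_edges]}} :=
  [pred p | toric_map p == 0].

(* q - n + r is written q + r - n because nat subtraction truncates. *)
Definition binomial_complete_intersection : Prop :=
  exists g : 'I_(nb_edges + nb_components - nb_vertices)%N ->
             {mpoly k[nb_edges]},
    (forall i, is_binomial (g i)) /\ generates g toric_ideal.
End Toric.

Definition CIO (k : fieldType) (G : sgraph) : Prop :=
  forall D : orientation G, binomial_complete_intersection k D.

Section Laurent.
Variables (k : fieldType) (n : nat).
Local Notation F := (@FracField.tofrac {mpoly k[n]}).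

Lemma tofracX_neq0 (m : 'X_{1..n}) : F 'X_[m] != 0.
Proof. by rewrite tofrac_eq0 -msupp_eq0 msuppX. Qed.

Lemma is_laurentF (p : {mpoly k[n]}) : is_laurent (F p).
Proof. by exists p, 0%MM; rewrite mpolyX0 tofrac1 divr1. Qed.

Lemma is_laurentD (f g : {fraction {mpoly k[n]}}) :
  is_laurent f -> is_laurent g -> is_laurent (f + g).
Proof.
move=> [p [a ->]] [q [b ->]]; exists (p * 'X_[b] + q * 'X_[a]), (a + b)%MM.
by rewrite mpolyXD tofracD !tofracM addf_div ?tofracX_neq0.
Qed.

Lemma is_laurentM (f g : {fraction {mpoly k[n]}}) :
  is_laurent f -> is_laurent g -> is_laurent (f * g).
Proof.
move=> [p [a ->]] [q [b ->]]; exists (p * q), (a + b)%MM.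
by rewrite mpolyXD !tofracM mulf_div.
Qed.
End Laurent.

Lemma toric_map_laurent (k : fieldType) (G : sgraph) (D : orientation G)
    (p : {mpoly k[nb_edges D]}) : is_laurent (toric_map p).
Proof.
have L1 : is_laurent (1 : {fraction {mpoly k[nb_vertices G]}}).
  by rewrite -tofrac1; apply: is_laurentF.
rewrite /toric_map /mmap; elim/big_ind: _ => [||m _].
- by rewrite -tofrac0; apply: is_laurentF.
- exact: is_laurentD.
apply: is_laurentM; first exact: is_laurentF.
rewrite /mmap1; elim/big_ind: _ => // [|l _]; first exact: is_laurentM.
elim: (m l) => [|e IHe]; rewrite ?expr0 // exprS; apply: is_laurentM => //.
by exists 'X_(enum_rank (arc_head l)), U_(enum_rank (arc_tail l))%MM.
Qed.

(* Main.v *)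
(* Extend an orientation of H = G[W] to G by directing every other edge upwards
   along a level function that vanishes on W and is positive outside. A binomial
   t^a - t^b of P_D has both monomials or neither in k[t_H], since a and b have
   the same total increase of level and only the edges of H increase it by 0.
   Killing the edges outside H therefore sends a binomial generating set of P_D
   to a generating set of P_H consisting of the generators supported on H.
   To count these, let A be the incidence matrix over the rationals: t^a - t^b
   lies in P_D iff (a - b) A = 0, and the exponent differences of a binomial
   generating set of P_D span the left kernel of A, of dimension q - n + r. Hence
   the q - n + r differences are linearly independent; those supported on H lie in
   the left kernel of the incidence matrix of H, so there are at most
   q_H - n_H + r_H of them. *)
From HB Require Import structures.
Require Import Defs.
From mathcomp Require Import all_boot all_order all_algebra.
From mathcomp Require Import fraction.
From mathcomp.multinomials Require Import ssrcomplements mpoly.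

Set Implicit Arguments.
Unset Strict Implicit.
Unset Printing Implicit Defensive.

Import GRing.Theory Num.Theory.
Local Open Scope ring_scope.

(** * Linear functionals on polynomials and rational exponent vectors *)

Section CoefficientSums.
Variables (k : fieldType) (q : nat).
Implicit Types (psi : 'X_{1..q} -> k) (p : {mpoly k[q]}).

(** The linear functional with value [psi m] on the monomial of exponent [m]; taking [psi] to be an
    indicator function tests one class of monomials at a time. *)
Definition coef_sum psi p : k := \sum_(m <- msupp p) p@_m * psi m.

(** The index set on the right is independent of the support of [p], so sums for several polynomials
    can be compared termwise; linearity follows. *)
Lemma coef_sumE psi p d : (msize p <= d)%N ->
  coef_sum psi p = \sum_(m : 'X_{1..q < d}) p@_m * psi m.
Proof.
move=> le_pd; pose I : subFinType _ := 'X_{1..q < d}.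
rewrite /coef_sum (big_mksub I) ?msupp_uniq //=; first last.
  by move=> x /msize_mdeg_lt /leq_trans; apply.
by rewrite big_rmcond //= => m /memN_msupp_eq0 ->; rewrite mul0r.
Qed.

Lemma coef_sum_is_linear psi : scalar (coef_sum psi).
Proof.
move=> a p r; pose d := maxn (msize (a *: p + r)) (maxn (msize p) (msize r)).
rewrite !(@coef_sumE _ _ d) ?leq_max ?leqnn ?orbT //.
rewrite mulr_sumr -big_split /=; apply: eq_bigr => m _.
by rewrite mcoeffD mcoeffZ mulrDl mulrA.
Qed.

HB.instance Definition _ psi :=
  GRing.isLinear.Build k {mpoly k[q]} k _ (coef_sum psi) (coef_sum_is_linear psi).

Lemma coef_sumX psi m : coef_sum psi 'X_[m] = psi m.
Proof. by rewrite /coef_sum msuppX big_seq1 mcoeffX eqxx mul1r. Qed.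

Lemma coef_sumM_binomial psi (c : {mpoly k[q]}) a b :
    (forall m, psi (m + a)%MM = psi (m + b)%MM) ->
  coef_sum psi (c * ('X_[a] - 'X_[b])) = 0.
Proof.
move=> psi_ab; rewrite (mpolyE c) mulr_suml linear_sum big1 // => m _.
rewrite -scalerAl linearZ /= mulrBr -!mpolyXD linearB /= !coef_sumX psi_ab.
by rewrite subrr mulr0.
Qed.

Definition exponent (m : 'X_{1..q}) : 'rV[rat]_q := \row_l (m l)%:R.

Lemma exponentD a b : exponent (a + b) = exponent a + exponent b.
Proof. by apply/rowP=> l; rewrite !mxE mnmDE natrD. Qed.

End CoefficientSums.

Lemma rat_row_denom q (v : 'rV[rat]_q) :
  exists2 d : rat, d != 0 & forall l, exists z : int, d * v 0 l = z%:~R.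
Proof.
exists (\prod_l (denq (v 0 l))%:~R) => [|l].
  by apply/prodf_neq0 => l _; rewrite intr_eq0 denq_neq0.
exists (numq (v 0 l) * \prod_(j | j != l) denq (v 0 j)).
rewrite (bigD1 l) //= rmorphM /= mulrAC numqE rmorph_prod /=.
by congr (_ * _); rewrite mulrC.
Qed.

Lemma row_exponent_diff q (v : 'rV[rat]_q) :
  exists2 d : rat, d != 0 &
    exists a b : 'X_{1..q}, d *: v = exponent a - exponent b.
Proof.
have [d d0 dv] := rat_row_denom v; exists d => //.
have [z zE] := fin_all_exists dv.
(* The integer vector [z] is split into its positive and negative parts; [Negz n] stands for -(n+1),
   whence [n.+1]. *)
exists [multinom (if z i is Posz n then n else 0%N) | i < q].
exists [multinom (if z i is Negz n then n.+1 else 0%N) | i < q].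
apply/rowP=> l; rewrite !mxE !mnmE zE.
case: (z l) => n /=; first by rewrite subr0.
by rewrite sub0r NegzE rmorphN.
Qed.


(** * Rank of the incidence matrix *)

Section IncidenceMatrix.
Variables (G : sgraph) (D : orientation G).
Local Notation q := (nb_edges D).
Local Notation n := (nb_vertices G).
Local Notation r := (nb_components G).

Lemma arcP (l : 'I_q) : Defs.arc D (arc_tail l) (arc_head l).
Proof. by have := enum_valP l; rewrite inE. Qed.

Lemma arc_index x y :
  Defs.arc D x y -> exists l : 'I_q, arc_tail l = x /\ arc_head l = y.
Proof.
move=> xy; have Dxy : (x, y) \in arcs D by rewrite inE.
by exists (enum_rank_in Dxy (x, y)); rewrite /arc_tail /arc_head enum_rankK_in.
Qed.

Lemma arc_inj (l l' : 'I_q) :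
  arc_tail l = arc_tail l' -> arc_head l = arc_head l' -> l = l'.
Proof.
rewrite /arc_tail /arc_head => tE hE; apply: enum_val_inj.
by rewrite [LHS]surjective_pairing tE hE -surjective_pairing.
Qed.

Definition incidence : 'M[rat]_(q, n) :=
  rowsub (enum_rank \o @arc_head G D) 1%:M - rowsub (enum_rank \o @arc_tail G D) 1%:M.

Lemma incidence_mul p (B : 'M[rat]_(n, p)) l j :
  (incidence *m B) l j =
    B (enum_rank (arc_head l)) j - B (enum_rank (arc_tail l)) j.
Proof. by rewrite mulmxBl -!rowsubE !mxE. Qed.

Lemma adj_connect_sym : connect_sym (@adj G).
Proof. exact/sym_connect_sym/adj_sym. Qed.

Lemma nb_componentsE : r = #|[pred x | roots (@adj G) x]|.
Proof. by apply: eq_card => x; rewrite !inE andbT. Qed.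

(** The columns of [C] are the indicator vectors of the components, and [S] selects the rows of the
    component roots, so [S *m C = 1] gives [C] rank r. From [AC] the rank is at most n - r; the
    factorization of the cokernel through [C] gives the reverse bound. *)
Lemma rank_incidence : \rank incidence = (n - r)%N.
Proof.
pose R := [pred x | roots (@adj G) x].
pose C : 'M[rat]_(n, #|R|) :=
  \matrix_(v, j) (fingraph.root (@adj G) (enum_val v) == enum_val j)%:R.
pose S : 'M[rat]_(#|R|, n) := rowsub (enum_rank \o enum_val) 1%:M.
have root_arc (l : 'I_q) :
    fingraph.root (@adj G) (arc_head l) = fingraph.root (@adj G) (arc_tail l).
  apply/esym/(fingraph.rootP adj_connect_sym)/connect1.
  by rewrite (arc_adj D) arcP.
have SM p (B : 'M[rat]_(n, p)) j c : (S *m B) j c = B (enum_rank (enum_val j)) c.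
  by rewrite -rowsubE mxE.
have SC : S *m C = 1%:M.
  apply/matrixP=> i j; rewrite SM !mxE enum_rankK.
  have /eqP-> : fingraph.root (@adj G) (enum_val i) == enum_val i.
    by have := enum_valP i; rewrite inE.
  by rewrite (inj_eq enum_val_inj).
have AC : incidence *m C = 0.
  by apply/matrixP=> l j; rewrite incidence_mul !mxE !enum_rankK root_arc subrr.
have rankC : \rank C = r.
  rewrite nb_componentsE; apply/eqP; rewrite eqn_leq rank_leq_col /=.
  by rewrite -[X in (X <= _)%N](mxrank1 rat) -SC mxrankM_maxr.
(* Columns killed by the incidence matrix are constant on components. *)
have const_coker : cokermx incidence = C *m (S *m cokermx incidence).
  apply/matrixP=> v j; rewrite [RHS]mxE.
  pose f x := cokermx incidence (enum_rank x) j.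
  have f_adj x y : adj x y -> f x = f y.
    rewrite (arc_adj D) => /orP[] /arc_index[l [tE hE]];
    have /eqP := incidence_mul (cokermx incidence) l j;
    rewrite mulmx_coker mxE tE hE eq_sym subr_eq0 => /eqP fE;
    by [rewrite /f fE|rewrite /f -fE].
  have f_connect x y : connect (@adj G) x y -> f x = f y.
    case/connectP=> s; elim: s x => [|z s IHs] x /=; first by move=> _ ->.
    by case/andP=> /f_adj-> /IHs; apply.
  have Rv : fingraph.root (@adj G) (enum_val v) \in R.
    by rewrite inE roots_root //; apply: adj_connect_sym.
  (* Row [v] of [C] has a single nonzero entry, at the root of the component of [v]. *)
  rewrite (bigD1 (enum_rank_in Rv (fingraph.root (@adj G) (enum_val v)))) //= big1.
    rewrite SM [C _ _]mxE enum_rankK_in // eqxx mul1r addr0.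
    rewrite -[LHS]/(cokermx incidence v j) -[v]enum_valK.
    by apply: f_connect; rewrite enum_rankK connect_root.
  move=> i ne_i; rewrite [C _ _]mxE; case: eqP => [rE|_]; last by rewrite mul0r.
  by case/eqP: ne_i; apply: enum_val_inj; rewrite enum_rankK_in.
have arith (t m c : nat) : (t + c <= m)%N -> (m - t <= c)%N -> t = (m - c)%N.
  by rewrite leq_subLR => le1 le2; rewrite -[t](addnK c); congr subn; apply/anti_leq/andP.
apply: arith; first by rewrite -rankC; apply: mulmx0_rank_max.
by rewrite -mxrank_coker const_coker -rankC; apply: mxrankM_maxl.
Qed.

Lemma rank_ker_incidence : \rank (kermx incidence) = (q + r - n)%N.
Proof.
have rn : (r <= n)%N by rewrite /nb_components /n_comp_mem max_card.
by rewrite mxrank_ker rank_incidence subnBA.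
Qed.
End IncidenceMatrix.

(** * Membership in the toric ideal and its binomials *)

Section ToricIdeal.
Variables (k : fieldType) (G : sgraph) (D : orientation G).
Local Notation q := (nb_edges D).
Local Notation n := (nb_vertices G).
Local Notation I_D := (@toric_ideal k G D).
Local Notation tofrac := (@FracField.tofrac {mpoly k[n]}).

Definition toric_var (l : 'I_q) : {fraction {mpoly k[n]}} :=
  xvar k (arc_head l) * (xvar k (arc_tail l))^-1.

Lemma toric_mapE (p : {mpoly k[q]}) :
  toric_map p = mmap (tofrac \o @mpolyC n k) toric_var p.
Proof. by []. Qed.

Definition head_monomial (m : 'X_{1..q}) : 'X_{1..n} :=
  (\sum_l U_(enum_rank (arc_head l)) *+ m l)%MM.
Definition tail_monomial (m : 'X_{1..q}) : 'X_{1..n} :=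
  (\sum_l U_(enum_rank (arc_tail l)) *+ m l)%MM.

Lemma toric_mapX m :
  toric_map 'X_[m] = tofrac 'X_[head_monomial m] / tofrac 'X_[tail_monomial m].
Proof.
rewrite toric_mapE mmapX /mmap1 -!mprodXnE !rmorph_prod /= -prodf_div.
apply: eq_bigr => l _; rewrite /toric_var /xvar exprMn exprVn.
by rewrite -!rmorphXn.
Qed.

Lemma exponent_incidence m :
  exponent m *m incidence D = exponent (head_monomial m) - exponent (tail_monomial m).
Proof.
apply/rowP=> v; rewrite !mxE !mnm_sumE !natr_sum -sumrB; apply: eq_bigr => l _.
by rewrite !mxE !mulmnE !mnm1E !natrM mulrBr ![_%:R * (m l)%:R]mulrC.
Qed.

(** Distinct Laurent monomials are linearly independent, so [p] is in the kernel iff the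
    coefficients of the monomials with any given image sum to zero. Letting [psi] range over all
    functions packages these conditions in a form that is easily pulled back to another graph. *)
Lemma toric_idealP (p : {mpoly k[q]}) :
  p \in I_D <->
  forall psi : 'rV[rat]_n -> k,
    coef_sum (fun m => psi (exponent m *m incidence D)) p = 0.
Proof.
pose T := (\sum_(m <- msupp p) tail_monomial m)%MM.
(* Multiplying by 'X_[T] clears all denominators of toric_map p. *)
pose cleared m := (head_monomial m + (T - tail_monomial m))%MM.
pose R : {mpoly k[n]} := \sum_(m <- msupp p) p@_m *: 'X_[cleared m].
have tail_le m : m \in msupp p -> (tail_monomial m <= T)%MM.
  move=> mp; apply/mnm_lepP => v; rewrite [T v]mnm_sumE (bigD1_seq m) ?msupp_uniq //=.
  exact: leq_addr.
have RE : toric_map p * tofrac 'X_[T] = tofrac R.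
  rewrite {1}toric_mapE {1}(mpolyE p) !raddf_sum mulr_suml.
  apply: eq_big_seq => m mp /=; rewrite mmapZ -toric_mapE toric_mapX.
  rewrite -(mul_mpolyC p@_m) /cleared !rmorphM /= -{1}(submK (tail_le m mp)).
  rewrite !mpolyXD !rmorphM /=.
  rewrite -!mulrA; congr (_ * (_ * _)); rewrite mulrCA mulVf ?mulr1 //.
  exact: tofracX_neq0.
have clearedE m : m \in msupp p ->
    exponent (cleared m) = exponent m *m incidence D + exponent T.
  move=> /tail_le le_mT; rewrite exponent_incidence -{1}(submK le_mT) /cleared !exponentD.
  by rewrite addrACA addNr addr0.
have -> : p \in I_D = (R == 0).
  by rewrite inE -[_ == 0 in RHS]tofrac_eq0 -RE mulf_eq0 (negPf (tofracX_neq0 _ _)) orbF.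
split=> [/eqP R0 psi|sum0].
  (* Subtracting [exponent T] undoes the shift made by clearing denominators. *)
  have := congr1 (coef_sum (fun z => psi (exponent z - exponent T))) R0.
  rewrite linear0 linear_sum /= => <-; apply: eq_big_seq => m mp.
  by rewrite linearZ /= coef_sumX clearedE // addrK.
apply/eqP/mpolyP=> z; rewrite mcoeff0.
(* This indicator collects exactly the terms of [p] that contribute to the coefficient of [R] at
   [z]. *)
rewrite -(sum0 (fun u => (u + exponent T == exponent z)%:R)).
rewrite /R raddf_sum; apply: eq_big_seq => m mp /=.
rewrite mcoeffZ mcoeffX -clearedE //; congr (_ * _%:R).
congr nat_of_bool; apply/eqP/eqP=> [->//|/rowP eqz]; apply/mnmP=> i.
by have /eqP := eqz i; rewrite !mxE eqr_nat => /eqP.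
Qed.

Lemma toric_ideal_binomial a b :
  'X_[a] - 'X_[b] \in I_D <->
  exponent a *m incidence D = exponent b *m incidence D.
Proof.
rewrite toric_idealP; split=> [sum0|eq_ab psi]; last first.
  by rewrite linearB /= !coef_sumX eq_ab subrr.
apply/eqP/contraT => /negPf ne_ab.
have /eqP := sum0 (fun u => (u == exponent a *m incidence D)%:R).
by rewrite linearB /= !coef_sumX eqxx [_ == exponent a *m _]eq_sym ne_ab subr0 oner_eq0.
Qed.

Lemma toric_ideal_lincomb (I : finType) (c g : I -> {mpoly k[q]}) :
  (forall i, g i \in I_D) -> \sum_i c i * g i \in I_D.
Proof.
move=> gP; rewrite inE toric_mapE raddf_sum /= big1 // => i _.
by have := gP i; rewrite inE toric_mapE rmorphM /= => /eqP->; rewrite mulr0.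
Qed.

Lemma generated_sub h (g : 'I_h -> {mpoly k[q]}) :
  generates g (I_D) -> forall i, g i \in I_D.
Proof.
move=> gen i; apply/gen; exists (fun j => (j == i)%:R).
by rewrite (bigD1 i) //= eqxx mul1r big1 ?addr0 // => j /negPf->; rewrite mul0r.
Qed.

(** Up to scaling, a kernel vector is a difference of natural exponents, hence gives a binomial of
    the ideal. Expanding that binomial in the generators forces its exponent difference into the
    span of theirs. *)
Lemma ker_incidence_sub h (a b : 'I_h -> 'X_{1..q}) :
    generates (fun i => 'X_[a i] - 'X_[b i]) (I_D) ->
  (kermx (incidence D) <= \matrix_i (exponent (a i) - exponent (b i)))%MS.
Proof.
move=> gen; set B := \matrix_i _; rewrite submxE; apply/eqP/row_matrixP => i.
rewrite row0 row_mul; set v := row i _.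
have vA : v *m incidence D = 0 by rewrite -row_mul mulmx_ker row0.
have [d d0 [x [y xy]]] := row_exponent_diff v.
have : 'X_[x] - 'X_[y] \in I_D.
  apply/toric_ideal_binomial/eqP.
  by rewrite -subr_eq0 -mulmxBl -xy -scalemxAl vA scaler0.
case/gen=> c xyE.
(* psi selects the monomials in one class modulo the row space of B; by
   homogeneity of the generators, coef_sum psi vanishes on the ideal. *)
pose psi (z : 'X_{1..q}) : k := (exponent z *m cokermx B == exponent x *m cokermx B)%:R.
have := congr1 (coef_sum psi) xyE.
rewrite linear_sum big1 => [|j _]; last first.
  apply: coef_sumM_binomial => m; rewrite /psi; congr (_ == _)%:R.
  rewrite !exponentD !mulmxDl; congr (_ + _); apply/eqP.
  rewrite -subr_eq0 -mulmxBl.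
  rewrite -[_ - _](rowK (fun i => exponent (a i) - exponent (b i))).
  by rewrite -row_mul mulmx_coker row0.
rewrite linearB /= !coef_sumX /psi eqxx => /eqP.
have [yx _|_] := eqVneq (exponent y *m _) _; last by rewrite subr0 oner_eq0.
by apply: (scalerI d0); rewrite scaler0 scalemxAl xy mulmxBl yx subrr.
Qed.
End ToricIdeal.

(** * Extending an orientation of the induced subgraph *)

Section Extension.
Variables (G : sgraph) (W : {set G}) (DH : orientation (induced W)).

Lemma extend_orientation : exists (D : orientation G) (level : G -> nat),
  (forall x y : induced W, Defs.arc D (val x) (val y) = Defs.arc DH x y) /\
  (forall x y, Defs.arc D x y ->
     level x <= level y ?= iff ((x \in W) && (y \in W)))%N.
Proof.
(* The successor makes levels outside [W] positive, and [enum_rank] makes them distinct, so every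
   edge not inside [W] joins two different levels. *)
pose level x := if x \in W then 0%N else (enum_rank x).+1.
pose ext x y := match insub x, insub y with
  | Some x', Some y' => Defs.arc DH x' y'
  | _, _ => adj x y && (level x < level y)%N
  end.
have level_inj x y : (x \notin W) || (y \notin W) -> x != y ->
    (level x < level y)%N = ~~ (level y < level x)%N.
  rewrite /level; case: (x \in W); case: (y \in W) => //= _.
  by rewrite !ltnS -leqNgt ltn_neqAle (inj_eq val_inj) (inj_eq enum_rank_inj) => ->.
have cross_adj x y : (x \notin W) || (y \notin W) ->
    adj x y = adj x y && (level x < level y)%N || adj y x && (level y < level x)%N.
  move=> nW; rewrite (adj_sym y x) -andb_orr; apply/esym/andb_idr => adj_xy.
  rewrite level_inj ?orNb //.
  by apply: contraTneq adj_xy => ->; rewrite adj_irrefl.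
have ext_val x y : ext (val x) (val y) = Defs.arc DH x y by rewrite /ext !valK.
have ext_cross x y : (x \notin W) || (y \notin W) ->
    ext x y = adj x y && (level x < level y)%N.
  rewrite /ext; case: insubP => // x' ->; case: insubP => // y' -> //.
have valsP x y : (exists x' y' : induced W, x = val x' /\ y = val y')
    \/ (x \notin W) || (y \notin W).
  have [Wx|_] := boolP (x \in W); last by right.
  have [Wy|_] := boolP (y \in W); last by right; rewrite orbT.
  by left; exists (Sub x Wx), (Sub y Wy); rewrite !SubK.
have ext_adj x y : adj x y = ext x y || ext y x.
  case: (valsP x y) => [[x' [y' [-> ->]]]|nW]; first by rewrite !ext_val -(arc_adj DH).
  rewrite ext_cross // (ext_cross y x); last by rewrite orbC.
  exact: cross_adj.
have ext_anti x y : ext x y -> ~~ ext y x.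
  case: (valsP x y) => [[x' [y' [-> ->]]]|nW].
    by rewrite !ext_val; apply: arc_anti.
  rewrite ext_cross // (ext_cross y x); last by rewrite orbC.
  by case/andP=> _ lt_xy; rewrite negb_and -leqNgt (ltnW lt_xy) orbT.
exists (Orientation ext_adj ext_anti), level; split=> [x y|x y /=]; first exact: ext_val.
case: (valsP x y) => [[x' [y' [-> ->]]] _|nW].
  by rewrite /level (valP x') (valP y'); apply/leqif_refl.
rewrite ext_cross // => /andP[_ lt_xy]; apply/leqifP.
by rewrite -[_ && _]negbK negb_and nW.
Qed.

Lemma arc_embedding (D : orientation G) :
    (forall x y : induced W, Defs.arc D (val x) (val y) = Defs.arc DH x y) ->
  exists iota : 'I_(nb_edges DH) -> 'I_(nb_edges D),
    [/\ injective iota,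
        forall l, arc_tail (iota l) = val (arc_tail l),
        forall l, arc_head (iota l) = val (arc_head l) &
        forall l, (l \in codom iota) = (arc_tail l \in W) && (arc_head l \in W)].
Proof.
move=> DE.
have lift (l : 'I_(nb_edges DH)) : exists l' : 'I_(nb_edges D),
    arc_tail l' = val (arc_tail l) /\ arc_head l' = val (arc_head l).
  by apply: arc_index; rewrite DE arcP.
have [iota iotaE] := fin_all_exists lift; exists iota; split.
- move=> l l' eq_l; have [t h] := iotaE l; have [t' h'] := iotaE l'.
  by apply: arc_inj; apply: val_inj; rewrite -?t -?h eq_l ?t' ?h'.
- by move=> l; case: (iotaE l).
- by move=> l; case: (iotaE l).
move=> l; apply/codomP/andP=> [[l' ->]|[tW hW]].
  by have [-> ->] := iotaE l'; split; apply: valP.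
pose x : induced W := exist (fun z => z \in W) _ tW.
pose y : induced W := exist (fun z => z \in W) _ hW.
have /arc_index[l' [t h]] : Defs.arc DH x y by rewrite -DE /= arcP.
exists l'; have [t' h'] := iotaE l'.
by apply: arc_inj; rewrite ?t' ?h' ?t ?h.
Qed.
End Extension.

(** * Retraction onto the polynomial ring on a subset of the edges *)

Section Retraction.
Variables (k : fieldType) (q' q : nat) (iota : 'I_q' -> 'I_q).
Hypothesis iota_inj : injective iota.

Definition extend_monomial (m : 'X_{1..q'}) : 'X_{1..q} :=
  (\sum_l U_(iota l) *+ m l)%MM.
Definition restrict_monomial (m : 'X_{1..q}) : 'X_{1..q'} :=
  [multinom m (iota l) | l < q'].
Definition supported (m : 'X_{1..q}) := [forall l, (m l != 0%N) ==> (l \in codom iota)].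

Lemma extend_monomial_iota m l : extend_monomial m (iota l) = m l.
Proof.
rewrite mnm_sumE (bigD1 l) //= mulmnE mnm1E eqxx mul1n big1 ?addn0 // => i ne_il.
by rewrite mulmnE mnm1E (inj_eq iota_inj) (negPf ne_il).
Qed.

Lemma extend_monomial0 m l : l \notin codom iota -> extend_monomial m l = 0%N.
Proof.
move=> nl; rewrite mnm_sumE big1 // => i _; rewrite mulmnE mnm1E.
by case: eqP nl => // <-; rewrite codom_f.
Qed.

Lemma restrict_monomialK m :
  supported m -> extend_monomial (restrict_monomial m) = m.
Proof.
move=> /forallP sm; apply/mnmP=> l.
have [/codomP[l' ->]|nl] := boolP (l \in codom iota).
  by rewrite extend_monomial_iota mnmE.
rewrite extend_monomial0 //; apply/esym/eqP.
by apply: contraNT nl => /(implyP (sm l)).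
Qed.

Lemma exponent_extend m :
  exponent (extend_monomial m) = exponent m *m rowsub iota 1%:M.
Proof.
apply/rowP=> l; rewrite !mxE mnm_sumE natr_sum; apply: eq_bigr => i _.
by rewrite !mxE mulmnE mnm1E natrM mulrC.
Qed.

Definition retract_var (l : 'I_q) : {mpoly k[q']} :=
  if [pick l' | iota l' == l] is Some l' then 'X_l' else 0.
Definition retract : {mpoly k[q]} -> {mpoly k[q']} :=
  mmap (@mpolyC q' k) retract_var.
HB.instance Definition _ := GRing.RMorphism.on retract.

Lemma retract_var_iota l : retract_var (iota l) = 'X_l.
Proof.
rewrite /retract_var; case: pickP => [l' /eqP/iota_inj->//|/(_ l)].
by rewrite eqxx.
Qed.

Lemma retract_extendX m : retract 'X_[extend_monomial m] = 'X_[m].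
Proof.
rewrite /extend_monomial -mprodXnE rmorph_prod mpolyXE_id; apply: eq_bigr => l _.
by rewrite rmorphXn /= /retract mmapX mmap1U retract_var_iota.
Qed.

Lemma retractX m :
  retract 'X_[m] = if supported m then 'X_[restrict_monomial m] else 0.
Proof.
case: ifP => [/restrict_monomialK {1}<-|]; first exact: retract_extendX.
move=> /negbT/forallPn[l]; rewrite negb_imply => /andP[ml nl].
rewrite /retract mmapX /mmap1 (bigD1 l) //= /retract_var.
case: pickP => [l' /eqP ll'|_]; first by rewrite -ll' codom_f in nl.
(* Since 0^0 = 1, the factor of a killed variable vanishes only because [m l] is nonzero. *)
by rewrite expr0n (negPf ml) mul0r.
Qed.

Definition extend (p : {mpoly k[q']}) : {mpoly k[q]} :=
  \sum_(m <- msupp p) p@_m *: 'X_[extend_monomial m].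

Lemma coef_sum_extend psi p :
  coef_sum psi (extend p) = coef_sum (psi \o extend_monomial) p.
Proof.
rewrite /extend linear_sum; apply: eq_bigr => m _.
by rewrite linearZ /= coef_sumX.
Qed.

Lemma extendK : cancel extend retract.
Proof.
move=> p; rewrite [RHS]mpolyE /extend raddf_sum; apply: eq_bigr => m _ /=.
rewrite -!mul_mpolyC rmorphM /= retract_extendX.
by rewrite /retract mmapC.
Qed.
End Retraction.

(** * Surviving generators, supports and incidence matrices *)

(** Fewer than [h] generators may survive the restriction; the default value 0 of [nth] pads the
    list without changing the ideal. *)
Lemma generates_seq (k : fieldType) q h (s : seq {mpoly k[q]})
    (I : {pred {mpoly k[q]}}) : (size s <= h)%N ->
    (forall p, p \in I <-> exists c : 'I_(size s) -> {mpoly k[q]},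
       p = \sum_i c i * s`_i) ->
  generates (fun i : 'I_h => s`_i) I.
Proof.
move=> sh gen p; rewrite gen; split=> [[c ->]|[c ->]]; last first.
  exists (fun i => c (widen_ord sh i)).
  rewrite (bigID (fun i : 'I_h => (i < size s)%N)) /= [X in _ + X]big1 ?addr0.
    by rewrite [LHS](big_ord_narrow sh).
  by move=> i; rewrite -leqNgt => /(nth_default 0)->; rewrite mulr0.
exists (fun i : 'I_h => if insub (val i) is Some j then c j else 0).
rewrite [RHS](bigID (fun i : 'I_h => (i < size s)%N)) /= [X in _ + X]big1 ?addr0.
  rewrite [RHS](big_ord_narrow sh) /=; apply: eq_bigr => i _.
  by rewrite (valK i).
by move=> i; rewrite -leqNgt => /(nth_default 0)->; rewrite mulr0.
Qed.

(** The right side is the total level increase, a sum of nonnegative terms that vanishes iff every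
    edge occurring in [m] is in the image of [iota]. Support thus depends on [m] only through
    [exponent m *m incidence D], which the two monomials of a toric binomial share. *)
Lemma supportedE (G : sgraph) (D : orientation G) q' (level : G -> nat)
    (iota : 'I_q' -> 'I_(nb_edges D)) :
    (forall l, level (arc_tail l) <= level (arc_head l) ?= iff (l \in codom iota))%N ->
  forall m, supported iota m =
    (exponent m *m incidence D *m (\col_v (level (enum_val v))%:R) == 0).
Proof.
move=> lvl m; set w := \col_v _.
have wE l : (incidence D *m w) l 0 =
    (level (arc_head l) - level (arc_tail l))%N%:R.
  by rewrite incidence_mul !mxE !enum_rankK natrB //; case: (lvl l).
have -> : (exponent m *m incidence D *m w == 0) =
    (\sum_l (m l * (level (arc_head l) - level (arc_tail l)))%N == 0%N).
  rewrite -mulmxA; set u := (_ *m _).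
  have -> : (u == 0) = (u 0 0 == 0).
    apply/eqP/eqP=> [->|u0]; first by rewrite mxE.
    by apply/matrixP=> i j; rewrite !ord1 u0 mxE.
  rewrite -(eqr_nat rat) natr_sum mxE; congr (_ == _); apply: eq_bigr => l _.
  by rewrite wE mxE natrM.
rewrite sum_nat_eq0; apply: eq_forallb => l /=.
rewrite muln_eq0 subn_eq0 -implyNb; congr (_ ==> _).
by rewrite -(lvl l).2 eqn_leq (lvl l).1.
Qed.

Lemma induced_incidence (G : sgraph) (W : {set G}) (DH : orientation (induced W))
    (D : orientation G) (iota : 'I_(nb_edges DH) -> 'I_(nb_edges D)) :
    (forall l, arc_tail (iota l) = val (arc_tail l)) ->
    (forall l, arc_head (iota l) = val (arc_head l)) ->
  rowsub iota 1%:M *m incidence D =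
  incidence DH *m
    rowsub (fun i : 'I_(nb_vertices (induced W)) => enum_rank (val (enum_val i))) 1%:M.
Proof.
move=> tE hE; apply/matrixP=> l y; rewrite -rowsubE incidence_mul !mxE.
by rewrite /= tE hE !enum_rankK.
Qed.

Lemma rowsub1_free n m (f : 'I_m -> 'I_n) :
  injective f -> row_free (rowsub f (1%:M : 'M[rat]_n)).
Proof.
move=> f_inj; apply/row_freeP; exists (rowsub f 1%:M)^T.
by rewrite -rowsubE; apply/matrixP=> i j; rewrite !mxE (inj_eq f_inj) eq_sym.
Qed.

(** * Heredity under induced subgraphs *)

Theorem corollary3p10 (k : fieldType) (G : sgraph) (W : {set G}) :
  CIO k G -> CIO k (induced W).
Proof.
move=> cioG DH.
have [D [level [DE lvl]]] := extend_orientation DH.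
have [iota [iota_inj tE hE cE]] := arc_embedding DE.
have [g [g_bin gen]] := cioG D.
have [a aP] := fin_all_exists g_bin; have [b gE] := fin_all_exists aP.
have {}gen : generates (fun i => 'X_[a i] - 'X_[b i]) (@toric_ideal k _ D).
  move=> p; rewrite gen; split=> -[c ->]; exists c; apply: eq_bigr => i _; by rewrite gE.
have ab_eq i : exponent (a i) *m incidence D = exponent (b i) *m incidence D.
  by apply/(toric_ideal_binomial k); apply: (generated_sub gen).
have iota_lvl (l : 'I_(nb_edges D)) :
    (level (arc_tail l) <= level (arc_head l) ?= iff (l \in codom iota))%N.
  by rewrite cE; apply/lvl/arcP.
have supp_ab i : supported iota (a i) = supported iota (b i).
  by rewrite !(supportedE iota_lvl) ab_eq.
pose E := rowsub iota (1%:M : 'M[rat]_(nb_edges D)).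
pose V := rowsub (fun i : 'I_(nb_vertices (induced W)) =>
  enum_rank (val (enum_val i))) (1%:M : 'M[rat]_(nb_vertices G)).
have EA : E *m incidence D = incidence DH *m V by apply: induced_incidence.
have V_free : row_free V.
  by apply: rowsub1_free => i j /enum_rank_inj/val_inj/enum_val_inj.
pose S := [set i | supported iota (a i)].
pose res := @restrict_monomial _ _ iota.
have expE m : supported iota m -> exponent m = exponent (res m) *m E.
  by move=> sm; rewrite -exponent_extend restrict_monomialK.
have supp_a i : i \in S -> supported iota (a i) by rewrite inE.
have supp_b i : i \in S -> supported iota (b i) by rewrite -supp_ab; apply: supp_a.
have res_eq i : i \in S ->
    exponent (res (a i)) *m incidence DH = exponent (res (b i)) *m incidence DH.
  (* [V] pads rows by zeros at the vertices outside [W], so it can be cancelled. *)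
  move=> Si; apply: (row_free_inj V_free).
  by rewrite -!mulmxA -EA !mulmxA -!expE ?supp_a ?supp_b.
pose gH i : {mpoly k[nb_edges DH]} := 'X_[res (a i)] - 'X_[res (b i)].
have genH p : p \in @toric_ideal k _ DH <->
    exists c : 'I_#|S| -> {mpoly k[nb_edges DH]}, p = \sum_j c j * gH (enum_val j).
  split=> [pH|[c ->]]; last first.
    apply: toric_ideal_lincomb => j; apply/toric_ideal_binomial/res_eq/enum_valP.
  have /gen[c pE] : extend iota p \in @toric_ideal k _ D.
    apply/toric_idealP => psi; rewrite coef_sum_extend.
    have /toric_idealP/(_ (fun u => psi (u *m V))) <- := pH.
    by apply: eq_bigr => m _; rewrite /= exponent_extend -!mulmxA EA.
  (* Retracting the expansion of [extend iota p] returns [p] and kills the generators outside [S],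
     both of whose monomials are unsupported. *)
  exists (fun j => retract iota (c (enum_val j))).
  rewrite -{1}(extendK iota_inj p) pE raddf_sum /=.
  rewrite (bigID (mem S)) /= [X in _ + X]big1 ?addr0.
    rewrite big_enum_val; apply: eq_bigr => j _.
    rewrite rmorphM rmorphB /= !retractX //.
    by rewrite supp_a ?supp_b ?enum_valP.
  move=> i; rewrite inE => /negPf nS.
  by rewrite rmorphM rmorphB /= !retractX // -supp_ab nS subrr mulr0.
have cardS :
    (#|S| <= nb_edges DH + nb_components (induced W) - nb_vertices (induced W))%N.
  pose B := \matrix_i (exponent (a i) - exponent (b i)).
  (* [B] has q + r - n rows, and its row space contains the left kernel of that same dimension. *)
  have B_free : row_free B.
    rewrite /row_free eqn_leq rank_leq_row /=.
    apply: leq_trans (mxrankS (ker_incidence_sub gen)).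
    by rewrite rank_ker_incidence.
  pose BH := \matrix_(j < #|S|)
    (exponent (res (a (enum_val j))) - exponent (res (b (enum_val j)))).
  have BHE : BH *m E = rowsub enum_val B.
    apply/row_matrixP => j; rewrite row_mul rowK row_rowsub rowK mulmxBl.
    by rewrite -!expE ?supp_a ?supp_b ?enum_valP.
  have BHA : BH *m incidence DH = 0.
    apply/row_matrixP => j; rewrite row_mul rowK row0 mulmxBl res_eq ?subrr //.
    exact: enum_valP.
  (* The rows of [B] indexed by [S] stay independent, so #|S| is their rank, which the left kernel
     for [DH] bounds through [BH]. *)
  have /eqP <- : row_free (rowsub (enum_val : 'I_#|S| -> _) B).
    by rewrite rowsubE /row_free mxrankMfree //; apply/rowsub1_free/enum_val_inj.
  rewrite -BHE (leq_trans (mxrankM_maxl _ _)) // -(rank_ker_incidence DH).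
  by apply/mxrankS/sub_kermxP.
pose s := [seq gH (enum_val j) | j : 'I_#|S|].
have size_s : size s = #|S| by rewrite size_map size_enum_ord.
exists (fun i => s`_i); split=> [i|].
  have [lt_i|ge_i] := ltnP i (size s); last first.
    (* The padding entry 0 is the binomial with both exponents zero. *)
    by exists 0%MM, 0%MM; rewrite nth_default // subrr.
  have /mapP[j _ ->] := mem_nth 0 lt_i.
  by exists (res (a (enum_val j))), (res (b (enum_val j))).
apply: generates_seq; rewrite ?size_s // => p; rewrite genH.
have nth_s (j : 'I_#|S|) : s`_j = gH (enum_val j).
  by rewrite (nth_map j) ?size_enum_ord // nth_ord_enum.
split=> -[c ->]; exists c; apply: eq_bigr => j _; by rewrite nth_s.
Qed.
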